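(* Let $\mathcal{A}$ be a triangulated category equipped with a bounded t-structure, and let $A\mapsto A(1)$ be an auto-equivalence of $\mathcal{A}$ (as a triangulated category) compatible with the t-structure. Let $A$ be an object of $\mathcal{A}$ equipped with a morphism $\phi: A[-1]\to A[1](1)$ such that for every integer $n\ge 1$ the iterate $\phi^n: A[-n]\to A[n](n)$ induces, on applying $H^0$, an isomorphism $H^{-n}(A)\to H^{n}(A)(n)$. Then there exists an isomorphism in $\mathcal{A}$ $$A\cong \bigoplus_{k\in\mathbb{Z}} H^{-k}(A)[k].$$
   Context: Write $[1]$ for the shift functor of $\mathcal{A}$ and $(\mathcal{A}^{\le 0},\mathcal{A}^{\ge 0})$ for the t-structure, with heart $\mathcal{A}^{\le 0}\cap\mathcal{A}^{\ge 0}$; put $\mathcal{A}^{\le n}=\mathcal{A}^{\le 0}[-n]$, $\mathcal{A}^{\ge n}=\mathcal{A}^{\ge 0}[-n]$ and $\mathcal{A}^{[a,b]}=\mathcal{A}^{\ge a}\cap\mathcal{A}^{\le b}$. $H^q:\mathcal{A}\to \mathcal{A}^{\le 0}\cap\mathcal{A}^{\ge 0}$ denotes the $q$-th cohomology functor of the t-structure, so $H^q(A)=H^0(A[q])$. The t-structure is bounded: every object of $\mathcal{A}$ lies in $\mathcal{A}^{[a,b]}$ for some integers $a\le b$; hence only finitely many $H^q(A)$ are nonzero and the direct sum is finite. The auto-equivalence $(1)$ is an exact (triangulated) functor, so it commutes with the shift up to the given natural isomorphism, and it is compatible with the t-structure, i.e. t-exact: it preserves $\mathcal{A}^{\le 0}$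 and $\mathcal{A}^{\ge 0}$. Thus $H^q(A(1))\cong H^q(A)(1)$ canonically. For $n\ge 0$, $(n)$ denotes its $n$-fold iterate. The iterate $\phi^n: A[-n]\to A[n](n)$ is the composition, for $j=0,1,\dots,n-1$ in this order, of the morphisms $\phi[-n+1+2j](j): A[-n+2j](j)\to A[-n+2j+2](j+1)$ (using the commutation of shift and $(1)$). The induced map is $H^0(\phi^n): H^{-n}(A)=H^0(A[-n])\to H^0(A[n](n))=H^n(A)(n)$. *)

(* Defs.v *)
From mathcomp Require Import all_boot all_order all_algebra.
From mathcomp Require Import boolp classical_sets.

Set Implicit Arguments.
Unset Strict Implicit.
Unset Printing Implicit Defensive.

Import Order.TTheory GRing.Theory Num.Theory.
Local Open Scope ring_scope.

Reserved Notation "g \oc f" (at level 40, left associativity).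

Record preadditive_cat := Preadditive {
  obj :> Type;
  mor : obj -> obj -> zmodType;
  idm : forall X, mor X X;
  compm : forall X Y Z, mor Y Z -> mor X Y -> mor X Z;
  comp1m : forall X Y (f : mor X Y), compm (idm Y) f = f;
  compm1 : forall X Y (f : mor X Y), compm f (idm X) = f;
  compA : forall W X Y Z (h : mor Y Z) (g : mor X Y) (f : mor W X),
    compm h (compm g f) = compm (compm h g) f;
  compDl : forall X Y Z (g g' : mor Y Z) (f : mor X Y),
    compm (g + g') f = compm g f + compm g' f;
  compDr : forall X Y Z (g : mor Y Z) (f f' : mor X Y),
    compm g (f + f') = compm g f + compm g f' }.

Arguments mor {p} X Y.
Arguments idm {p} X.
Arguments compm {p X Y Z} g f.
Notation "g \oc f" := (compm g f) : ring_scope.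

Definition is_zero (C : preadditive_cat) (Z : C) : Prop :=
  (forall X (f : mor X Z), f = 0) /\ (forall X (f : mor Z X), f = 0).

Definition is_biproduct (C : preadditive_cat) (X Y S : C) (i1 : mor X S)
    (i2 : mor Y S) (p1 : mor S X) (p2 : mor S Y) : Prop :=
  [/\ p1 \oc i1 = idm X, p2 \oc i2 = idm Y, p1 \oc i2 = 0, p2 \oc i1 = 0
    & i1 \oc p1 + i2 \oc p2 = idm S].

Record additive_cat := Additive {
  preadd :> preadditive_cat;
  zero_ex : exists Z : preadd, is_zero Z;
  biproduct_ex : forall X Y : preadd,
    exists S (i1 : mor X S) (i2 : mor Y S) (p1 : mor S X) (p2 : mor S Y),
    is_biproduct i1 i2 p1 p2 }.

Record iso (C : preadditive_cat) (X Y : C) := Iso {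
  ifwd :> mor X Y;
  iinv : mor Y X;
  ifwdK : iinv \oc ifwd = idm X;
  iinvK : ifwd \oc iinv = idm Y }.

Definition isomorphic (C : preadditive_cat) (X Y : C) : Prop := inhabited (iso X Y).

Definition is_iso (C : preadditive_cat) (X Y : C) (f : mor X Y) : Prop :=
  exists g : mor Y X, g \oc f = idm X /\ f \oc g = idm Y.

(* [S] with the morphisms [in_ i] is the coproduct of the family [E].  For a
   family with finitely many nonzero members this is their biproduct. *)
Definition is_direct_sum (C : preadditive_cat) (I : Type) (E : I -> C) (S : C)
    (in_ : forall i, mor (E i) S) : Prop :=
  forall (Y : C) (f : forall i, mor (E i) Y),
    exists! u : mor S Y, forall i, u \oc in_ i = f i.

Record add_functor (C D : preadditive_cat) := Functor {
  fobj :> C -> D;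
  fmap : forall X Y : C, mor X Y -> mor (fobj X) (fobj Y);
  fmap1 : forall X, fmap (idm X) = idm (fobj X);
  fmapM : forall X Y Z (g : mor Y Z) (f : mor X Y),
    fmap (g \oc f) = fmap g \oc fmap f;
  fmapD : forall X Y (f g : mor X Y), fmap (f + g) = fmap f + fmap g }.

Arguments fmap {C D} F {X Y} f : rename.

Definition is_equivalence (C D : preadditive_cat) (F : add_functor C D) : Prop :=
  exists (G : add_functor D C)
         (eta : forall X : C, iso X (G (F X)))
         (eps : forall Y : D, iso (F (G Y)) Y),
    (forall (X X' : C) (f : mor X X'),
        eta X' \oc f = fmap G (fmap F f) \oc eta X) /\
    (forall (Y Y' : D) (f : mor Y Y'),
        eps Y' \oc fmap F (fmap G f) = f \oc eps Y).

(* The shift is a coherent action of the group [int] by additive functors: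
   [shiftD] identifies X[m][n] with X[p] whenever m + n = p.  This is the same
   as an auto-equivalence [1] together with its integral powers; a separate
   index [p] avoids transport along equalities of integers. *)
Record shifted_cat := ShiftedCat {
  scat :> additive_cat;
  sh : int -> add_functor scat scat;
  shift0 : forall X : scat, iso (sh 0 X) X;
  shiftD : forall (m n p : int) (e : m + n = p) (X : scat),
    iso (sh n (sh m X)) (sh p X);
  shift0_nat : forall X Y (f : mor X Y),
    shift0 Y \oc fmap (sh 0) f = f \oc shift0 X;
  shiftD_nat : forall m n p (e : m + n = p) X Y (f : mor X Y),
    shiftD e Y \oc fmap (sh n) (fmap (sh m) f)
    = fmap (sh p) f \oc shiftD e X;
  shiftD0 : forall m (e : m + 0 = m) X,
    shiftD e X = shift0 (sh m X) :> mor _ _;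
  shift0D : forall n (e : 0 + n = n) X,
    shiftD e X = fmap (sh n) (shift0 X) :> mor _ _;
  shiftDA : forall m n r a b c (e1 : m + n = a) (e2 : n + r = b)
      (e3 : a + r = c) (e4 : m + b = c) X,
    shiftD e3 X \oc fmap (sh r) (shiftD e1 X)
    = shiftD e4 X \oc shiftD e2 (sh m X) }.

Arguments sh {s} n.
Arguments shift0 {s} X.
Arguments shiftD {s m n p} e X.

(* [dist_tri f g h]: X --f--> Y --g--> Z --h--> X[1] is distinguished. *)
Record triangulated_cat := Triangulated {
  tcat :> shifted_cat;
  dist_tri : forall X Y Z : tcat,
    mor X Y -> mor Y Z -> mor Z (sh 1 X) -> Prop;
  dist_iso : forall (X Y Z X' Y' Z' : tcat)
      (f : mor X Y) (g : mor Y Z) (h : mor Z (sh 1 X))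
      (f' : mor X' Y') (g' : mor Y' Z') (h' : mor Z' (sh 1 X'))
      (a : iso X X') (b : iso Y Y') (c : iso Z Z'),
    dist_tri f g h ->
    b \oc f = f' \oc a -> c \oc g = g' \oc b ->
    fmap (sh 1) a \oc h = h' \oc c ->
    dist_tri f' g' h';
  dist_id : forall X Z : tcat, is_zero Z ->
    dist_tri (idm X) (0 : mor X Z) (0 : mor Z (sh 1 X));
  dist_cone : forall (X Y : tcat) (f : mor X Y),
    exists Z (g : mor Y Z) (h : mor Z (sh 1 X)), dist_tri f g h;
  dist_rot : forall (X Y Z : tcat)
      (f : mor X Y) (g : mor Y Z) (h : mor Z (sh 1 X)),
    dist_tri f g h <-> dist_tri g h (- fmap (sh 1) f);
  dist_mor : forall (X Y Z X' Y' Z' : tcat)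
      (f : mor X Y) (g : mor Y Z) (h : mor Z (sh 1 X))
      (f' : mor X' Y') (g' : mor Y' Z') (h' : mor Z' (sh 1 X'))
      (a : mor X X') (b : mor Y Y'),
    dist_tri f g h -> dist_tri f' g' h' -> b \oc f = f' \oc a ->
    exists c : mor Z Z',
      c \oc g = g' \oc b /\ fmap (sh 1) a \oc h = h' \oc c;
  dist_oct : forall (X Y Z X' Y' Z' : tcat) (f : mor X Y) (g : mor Y Z)
      (u : mor Y Z') (d : mor Z' (sh 1 X))
      (v : mor Z X') (e : mor X' (sh 1 Y))
      (w : mor Z Y') (k : mor Y' (sh 1 X)),
    dist_tri f u d -> dist_tri g v e -> dist_tri (g \oc f) w k ->
    exists (a : mor Z' Y') (b : mor Y' X'),
      dist_tri a b (fmap (sh 1) u \oc e) /\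
      [/\ a \oc u = w \oc g, k \oc a = d, b \oc w = v
        & e \oc b = fmap (sh 1) f \oc k] }.

Arguments dist_tri {t X Y Z} f g h.

(* A triangulated auto-equivalence.  The commutation with [1] is given, as
   for [sh], coherently for all powers of the shift. *)
Record auto_equivalence (T : triangulated_cat) := AutoEquivalence {
  aefun :> add_functor T T;
  aeshift : forall (m : int) (X : T), iso (aefun (sh m X)) (sh m (aefun X));
  aeshift_nat : forall m X Y (f : mor X Y),
    aeshift m Y \oc fmap aefun (fmap (sh m) f)
    = fmap (sh m) (fmap aefun f) \oc aeshift m X;
  aeshift0 : forall X,
    shift0 (aefun X) \oc aeshift 0 X = fmap aefun (shift0 X);
  aeshiftD : forall m n p (e : m + n = p) X,
    aeshift p X \oc fmap aefun (shiftD e X)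
    = shiftD e (aefun X) \oc (fmap (sh n) (aeshift m X)
                              \oc aeshift n (sh m X));
  aedist : forall (X Y Z : T)
      (f : mor X Y) (g : mor Y Z) (h : mor Z (sh 1 X)),
    dist_tri f g h ->
    dist_tri (fmap aefun f) (fmap aefun g) (aeshift 1 X \oc fmap aefun h);
  ae_equiv : is_equivalence aefun }.

Section Exactness.
Variable T : triangulated_cat.

(* What is needed for the morphisms induced on truncations to be well defined. *)
Lemma comp0m (X Y Z : T) (f : mor X Y) : (0 : mor Y Z) \oc f = 0.
Proof. by apply: (@addrI _ (0 \oc f)); rewrite -compDl !addr0. Qed.
Lemma compm0 (X Y Z : T) (g : mor Y Z) : g \oc (0 : mor X Y) = 0.
Proof. by apply: (@addrI _ (g \oc 0)); rewrite -compDr !addr0. Qed.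
Lemma compNm (X Y Z : T) (g : mor Y Z) (f : mor X Y) : (- g) \oc f = - (g \oc f).
Proof. by apply: (@addrI _ (g \oc f)); rewrite -compDl !subrr comp0m. Qed.
Lemma compmN (X Y Z : T) (g : mor Y Z) (f : mor X Y) : g \oc (- f) = - (g \oc f).
Proof. by apply: (@addrI _ (g \oc f)); rewrite -compDr !subrr compm0. Qed.
Lemma fmap0 (F : add_functor T T) (X Y : T) : fmap F (0 : mor X Y) = 0.
Proof. by apply: (@addrI _ (fmap F 0)); rewrite -fmapD !addr0. Qed.

Lemma zeroE (Z : T) : idm Z = 0 -> is_zero Z.
Proof.
by move=> Z0; split=> X f; [rewrite -[f]comp1m Z0 comp0m|rewrite -[f]compm1 Z0 compm0].
Qed.

Lemma zero_sh n (Z : T) : is_zero Z -> is_zero (sh n Z).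
Proof. by move=> [Z0 _]; apply: zeroE; rewrite -fmap1 (Z0 _ (idm Z)) fmap0. Qed.

Definition shK (m n : int) (e : m + n = 0) (X : T) : mor (sh n (sh m X)) X :=
  shift0 X \oc shiftD e X.
Definition shKV (m n : int) (e : m + n = 0) (X : T) : mor X (sh n (sh m X)) :=
  iinv (shiftD e X) \oc iinv (shift0 X).

Lemma shKVK m n (e : m + n = 0) X : shKV e X \oc shK e X = idm _.
Proof. by rewrite /shK /shKV -!compA (compA (iinv (shift0 _))) ifwdK comp1m ifwdK. Qed.
Lemma shKK m n (e : m + n = 0) X : shK e X \oc shKV e X = idm _.
Proof. by rewrite /shK /shKV -!compA (compA (shiftD _ _)) iinvK comp1m iinvK. Qed.
Lemma shK_nat m n (e : m + n = 0) X Y (f : mor X Y) :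
  shK e Y \oc fmap (sh n) (fmap (sh m) f) = f \oc shK e X.
Proof. by rewrite /shK -compA shiftD_nat !compA shift0_nat. Qed.

Lemma sh1_inj (X Y : T) (f g : mor X Y) : fmap (sh 1) f = fmap (sh 1) g -> f = g.
Proof.
move=> fg; have e : 1 + -1 = 0 :> int by [].
by rewrite -[f]compm1 -[g]compm1 -(shKK e) (compA f) (compA g) -!shK_nat fg.
Qed.

Lemma sh_full m n (e : m + n = 0) (X Y : T) (c : mor (sh m X) (sh m Y)) :
  exists f : mor X Y, fmap (sh m) f = c.
Proof.
have e' : n + m = 0 by rewrite addrC.
have inj k l (ekl : k + l = 0) (U V : T) (f g : mor U V) :
    fmap (sh k) f = fmap (sh k) g -> f = g.
  by move=> fg; rewrite -[f]compm1 -[g]compm1 -(shKK ekl) (compA f) (compA g) -!shK_nat fg.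
exists (shK e Y \oc fmap (sh n) c \oc shKV e X).
apply: (inj _ _ e'); rewrite -[LHS]comp1m -(shKVK e Y) -(compA (shKV e Y)) shK_nat.
rewrite -(compA (shK e Y \oc fmap (sh n) c) (shKV e X)) shKVK compm1.
by rewrite compA shKVK comp1m.
Qed.

Lemma dist_comp0 (X Y Z : T) (f : mor X Y) (g : mor Y Z) (h : mor Z (sh 1 X)) :
  dist_tri f g h -> g \oc f = 0.
Proof.
move=> d; have [O zO] := zero_ex T.
have [|c [<- _]] := dist_mor (dist_id X zO) d (a := idm X) (b := f).
  by [].
by rewrite compm0.
Qed.

Lemma dist_lift (W X Y Z : T) (f : mor X Y) (g : mor Y Z) (h : mor Z (sh 1 X))
  (u : mor W Y) : dist_tri f g h -> g \oc u = 0 ->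
  exists v : mor W X, f \oc v = u.
Proof.
move=> d gu; have [O zO] := zero_ex T.
have dW := (dist_rot _ _ _).1 (dist_id W zO).
have [|c [_]] := dist_mor dW ((dist_rot _ _ _).1 d) (a := u) (b := 0).
  by rewrite comp0m gu.
rewrite compmN compNm fmap1 compm1 => /oppr_inj fc.
have [v vc] := sh_full (erefl : 1 + -1 = 0 :> int) c.
by exists v; apply: sh1_inj; rewrite fmapM vc.
Qed.

Lemma dist_ext (W X Y Z : T) (f : mor X Y) (g : mor Y Z) (h : mor Z (sh 1 X))
  (u : mor Y W) : dist_tri f g h -> u \oc f = 0 ->
  exists v : mor Z W, v \oc g = u.
Proof.
move=> d uf; have [O zO] := zero_ex T.
have dW : dist_tri (0 : mor O W) (idm W) (0 : mor W (sh 1 O)).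
  by apply/dist_rot; rewrite fmap0 oppr0; apply: dist_id; apply: zero_sh.
have [|c [cg _]] := dist_mor d dW (a := 0) (b := u); first by rewrite compm0.
by exists c; rewrite cg comp1m.
Qed.

End Exactness.

(* The essential image of the full subcategory [P] under [-n]; with
   P = A^{<=0} (resp. A^{>=0}) this is A^{<=n} (resp. A^{>=n}). *)
Definition shifted (T : triangulated_cat) (P : T -> Prop) (n : int) (X : T) : Prop :=
  exists2 Y : T, P Y & isomorphic X (sh (- n) Y).

Record trunc_triangle (T : triangulated_cat) (le0 ge0 : T -> Prop) (X : T) :=
  TruncTriangle {
    tr_le : T;
    tr_ge : T;
    tr_in : mor tr_le X;
    tr_pr : mor X tr_ge;
    tr_bd : mor tr_ge (sh 1 tr_le);
    tr_leP : le0 tr_le;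
    tr_geP : shifted ge0 1 tr_ge;
    tr_dist : dist_tri tr_in tr_pr tr_bd }.

Record tstructure (T : triangulated_cat) := TStructure {
  le0 : T -> Prop;
  ge0 : T -> Prop;
  le0_iso : forall X Y, isomorphic X Y -> le0 X -> le0 Y;
  ge0_iso : forall X Y, isomorphic X Y -> ge0 X -> ge0 Y;
  le0_le1 : forall X, le0 X -> shifted le0 1 X;
  ge1_ge0 : forall X, shifted ge0 1 X -> ge0 X;
  hom_le0_ge1 : forall X Y, le0 X -> shifted ge0 1 Y ->
    forall f : mor X Y, f = 0;
  trunc_ex : forall X, inhabited (trunc_triangle le0 ge0 X) }.

Definition tbounded (T : triangulated_cat) (t : tstructure T) : Prop :=
  forall X : T, exists a b : int,
    [/\ a <= b, shifted (ge0 t) a X & shifted (le0 t) b X].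

Definition t_exact (T : triangulated_cat) (t : tstructure T) (F : add_functor T T)
    : Prop :=
  (forall X, le0 t X -> le0 t (F X)) /\ (forall X, ge0 t X -> ge0 t (F X)).

Section Cohomology.
Variables (T : triangulated_cat) (t : tstructure T).

Definition trunc_of (X : T) : trunc_triangle (le0 t) (ge0 t) X :=
  inhabited_witness (trunc_ex t X).

Definition tau_le0 (X : T) : T := tr_le (trunc_of X).
Definition tau_ge1 (X : T) : T := tr_ge (trunc_of X).

Lemma le0_sh1 (X : T) : le0 t X -> le0 t (sh 1 X).
Proof.
case/le0_le1=> Y lY [i]; apply: le0_iso lY; constructor.
have e : -1 + 1 = 0 :> int by [].
apply: (@Iso _ _ _ (fmap (sh 1) (iinv i) \oc shKV e Y)
                   (shK e Y \oc fmap (sh 1) i)).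
- by rewrite -compA (compA (fmap _ i)) -fmapM iinvK fmap1 comp1m shKK.
- by rewrite -compA (compA (shKV _ _)) shKVK comp1m -fmapM ifwdK fmap1.
Qed.

Lemma tau_le0_ump (W X : T) (f : mor W X) : le0 t W ->
  exists! u : mor W (tau_le0 X), tr_in (trunc_of X) \oc u = f.
Proof.
move=> lW; have d := tr_dist (trunc_of X).
have [|u uf] := dist_lift d (u := f); first exact: hom_le0_ge1 lW (tr_geP _) _.
exists u; split=> // v vf.
apply/eqP; rewrite -subr_eq0; apply/eqP; apply: sh1_inj.
have d' := (dist_rot _ _ _).1 ((dist_rot _ _ _).1 d).
have [|w <-] := dist_lift d' (u := fmap (sh 1) (u - v)).
  by rewrite compNm -fmapM compDr compmN uf vf subrr fmap0 oppr0.
by rewrite (hom_le0_ge1 (le0_sh1 lW) (tr_geP _) w) compm0 fmap0.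
Qed.

Lemma tau_ge1_ump (X W : T) (f : mor X W) : shifted (ge0 t) 1 W ->
  exists! u : mor (tau_ge1 X) W, u \oc tr_pr (trunc_of X) = f.
Proof.
move=> gW; have d := tr_dist (trunc_of X).
have [|u uf] := dist_ext d (u := f); first exact: hom_le0_ge1 (tr_leP _) gW _.
exists u; split=> // v vf.
apply/eqP; rewrite -subr_eq0; apply/eqP.
have [|w <-] := dist_ext ((dist_rot _ _ _).1 d) (u := u - v).
  by rewrite compDl compNm uf vf subrr.
by rewrite (hom_le0_ge1 (le0_sh1 (tr_leP _)) gW w) comp0m.
Qed.

(* The morphism induced on truncations is the unique one making the square
   with the truncation triangle commute (existence and
   uniqueness: [tau_le0_ump] and [tau_ge1_ump]), so the default 0 of [xget]
   is never used. *)
Definition tau_le0_map (X Y : T) (f : mor X Y) : mor (tau_le0 X) (tau_le0 Y) :=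
  xget 0 [set u | tr_in (trunc_of Y) \oc u = f \oc tr_in (trunc_of X)]%classic.
Definition tau_ge1_map (X Y : T) (f : mor X Y) : mor (tau_ge1 X) (tau_ge1 Y) :=
  xget 0 [set u | u \oc tr_pr (trunc_of X) = tr_pr (trunc_of Y) \oc f]%classic.

Lemma tau_le0_mapP (X Y : T) (f : mor X Y) :
  tr_in (trunc_of Y) \oc tau_le0_map f = f \oc tr_in (trunc_of X).
Proof.
have [u [uP _]] := tau_le0_ump (f \oc tr_in (trunc_of X)) (tr_leP _).
exact: (@xgetI _ 0 [set v | tr_in (trunc_of Y) \oc v
                         = f \oc tr_in (trunc_of X)]%classic u uP).
Qed.

Lemma tau_ge1_mapP (X Y : T) (f : mor X Y) :
  tau_ge1_map f \oc tr_pr (trunc_of X) = tr_pr (trunc_of Y) \oc f.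
Proof.
have [u [uP _]] := tau_ge1_ump (tr_pr (trunc_of Y) \oc f) (tr_geP _).
exact: (@xgetI _ 0 [set v | v \oc tr_pr (trunc_of X)
                         = tr_pr (trunc_of Y) \oc f]%classic u uP).
Qed.

Definition tau_ge0 (X : T) : T := sh 1 (tau_ge1 (sh (-1) X)).
Definition tau_ge0_map (X Y : T) (f : mor X Y) : mor (tau_ge0 X) (tau_ge0 Y) :=
  fmap (sh 1) (tau_ge1_map (fmap (sh (-1)) f)).

Definition coh0 (X : T) : T := tau_ge0 (tau_le0 X).
Definition coh0_map (X Y : T) (f : mor X Y) : mor (coh0 X) (coh0 Y) :=
  tau_ge0_map (tau_le0_map f).

Definition coh (q : int) (X : T) : T := coh0 (sh q X).

End Cohomology.

Section Iterates.
Variables (T : triangulated_cat) (F : auto_equivalence T).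

(* X(j), with X(j+1) = X(1)(j) *)
Fixpoint twist (j : nat) (X : T) : T :=
  if j is j'.+1 then twist j' (F X) else X.

Fixpoint twist_map (j : nat) (X Y : T) (f : mor X Y) :
    mor (twist j X) (twist j Y) :=
  if j is j'.+1 then twist_map j' (fmap F f) else f.

Definition shift_cast (m n : int) (e : m = n) (X : T) :
    mor (sh m X) (sh n X) :=
  let: erefl := e in idm (sh m X).

Variables (A : T) (phi : mor (sh (-1) A) (F (sh 1 A))).

(* phi[m] : A[m-1] -> A[m+1](1), after the identifications
   A[-1][m] = A[m-1] and A[1](1)[m] = A[1][m](1) = A[m+1](1). *)
Definition phi_shift (m p q : int) (ep : -1 + m = p) (eq : 1 + m = q) :
    mor (sh p A) (F (sh q A)) :=
  fmap F (shiftD eq A) \oc iinv (aeshift F m (sh 1 A))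
  \oc fmap (sh m) phi \oc iinv (shiftD ep A).

Fact phi_idx0 (n : nat) : - n%:Z = - n%:Z + (2 * 0)%N%:Z.
Proof. by rewrite muln0 addr0. Qed.

Fact phi_idxl (n j : nat) :
  -1 + (- n%:Z + 1 + (2 * j)%N%:Z) = - n%:Z + (2 * j)%N%:Z.
Proof. by rewrite addrA [-1 + _]addrC addrK. Qed.

Fact phi_idxr (n j : nat) :
  1 + (- n%:Z + 1 + (2 * j)%N%:Z) = - n%:Z + (2 * j.+1)%N%:Z.
Proof.
by rewrite mulnS PoszD addrA (addrC 1) -!addrA; congr (_ + _); rewrite addrA.
Qed.

Fact phi_idxn (n : nat) : - n%:Z + (2 * n)%N%:Z = n%:Z.
Proof. by rewrite mul2n -addnn PoszD addKr. Qed.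

(* The composite of the first [j] factors phi[-n+1+2i](i), i < j. *)
Fixpoint phi_partial (n j : nat) :
    mor (sh (- n%:Z) A) (twist j (sh (- n%:Z + (2 * j)%N%:Z) A)) :=
  if j is j'.+1 then
    twist_map j' (phi_shift (phi_idxl n j') (phi_idxr n j'))
    \oc phi_partial n j'
  else shift_cast (phi_idx0 n) A.

Definition phi_iter (n : nat) :
    mor (sh (- n%:Z) A) (twist n (sh n%:Z A)) :=
  twist_map n (shift_cast (phi_idxn n) A) \oc phi_partial n n.

End Iterates.

(* Main.v *)
(* Let B be a retract of A lying in [-n, n] and having the same H^j as A for
   |j| <= n.  Since B[-n] is in A^{>=0} and B[n](n) is in A^{<=0}, the map
   H^0(phi^n) is the composite
     H^{-n}(B) -> B[-n] -> A[-n] -> A[n](n) -> B[n](n) -> H^n(B)(n),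
   so its invertibility splits off from B both the bottom truncation H^{-n}(B)[n]
   and the top truncation H^n(B)[-n].  The complement lies in [-n+1, n-1] and is
   again such a retract, now for n-1; descending induction from B = A decomposes
   A. *)

Require Import Defs.
From mathcomp Require Import all_boot all_order all_algebra.
From mathcomp Require Import zify.

Set Implicit Arguments.
Unset Strict Implicit.
Unset Printing Implicit Defensive.

(* [iinv] and [compA] are shadowed by MathComp without this. *)
Import Defs.
Import Order.TTheory GRing.Theory Num.Theory.
Local Open Scope ring_scope.

(** * Isomorphisms in preadditive categories *)

Section Isomorphisms.
Variable C : preadditive_cat.

Lemma isomorphic_refl (X : C) : isomorphic X X.
Proof. by constructor; exists (idm X) (idm X); rewrite comp1m. Qed.

Lemma isomorphic_sym (X Y : C) : isomorphic X Y -> isomorphic Y X.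
Proof. by case=> i; constructor; exists (iinv i) (ifwd i); rewrite ?iinvK ?ifwdK. Qed.

Lemma isomorphic_trans (X Y Z : C) :
  isomorphic X Y -> isomorphic Y Z -> isomorphic X Z.
Proof.
case=> i [j]; constructor; exists (j \oc i) (iinv i \oc iinv j).
- by rewrite -compA (compA (iinv j)) ifwdK comp1m ifwdK.
- by rewrite -compA (compA i) iinvK comp1m iinvK.
Qed.

Lemma isomorphic_fmap (D : preadditive_cat) (F : add_functor C D) (X Y : C) :
  isomorphic X Y -> isomorphic (F X) (F Y).
Proof.
case=> i; constructor; exists (fmap F i) (fmap F (iinv i)).
- by rewrite -fmapM ifwdK fmap1.
- by rewrite -fmapM iinvK fmap1.
Qed.

End Isomorphisms.

Definition comp_functor (C D E : preadditive_cat) (G : add_functor D E)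
  (F : add_functor C D) : add_functor C E.
Proof.
exists (fun X => G (F X)) (fun X Y f => fmap G (fmap F f)).
- by move=> X; rewrite !fmap1.
- by move=> X Y Z g f; rewrite !fmapM.
- by move=> X Y f g; rewrite !fmapD.
Defined.

(** * Shifts and split monomorphisms in triangulated categories *)

Section Triangulated.
Variable T : triangulated_cat.
Implicit Types X Y Z W : T.

Lemma sh_faithful m X Y (f g : mor X Y) : fmap (sh m) f = fmap (sh m) g -> f = g.
Proof.
move=> fg; rewrite -[f]compm1 -[g]compm1 -(shKK (subrr m)).
by rewrite (compA f) (compA g) -!shK_nat fg.
Qed.

Lemma shKV_nat m n (e : m + n = 0) X Y (f : mor X Y) :
  shKV e Y \oc f = fmap (sh n) (fmap (sh m) f) \oc shKV e X.
Proof.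
rewrite -[LHS]compm1 -(shKK e X) (compA _ (shK e X)) -(compA _ f) -shK_nat.
by rewrite (compA (shKV e Y)) shKVK comp1m.
Qed.

Lemma isomorphic_shD m n X : isomorphic (sh n (sh m X)) (sh (m + n) X).
Proof. by constructor; apply: shiftD. Qed.

Lemma isomorphic_shK m n X : m + n = 0 -> isomorphic (sh n (sh m X)) X.
Proof.
by move=> e; constructor; exists (shK e X) (shKV e X); rewrite ?shKK ?shKVK.
Qed.

(** In the triangle on [a] the connecting map [h] vanishes, because [a[1] h = 0] and [a[1]] is a
    split mono. Hence the identity of the cone lifts through [p], and the lift [j] is corrected to
    [j - a c j], which [c] kills. *)
Lemma split_mono_complement (E B : T) (a : mor E B) (c : mor B E) :
  c \oc a = idm E ->
  exists D (i : mor D B) (p : mor B D),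
    [/\ p \oc i = idm D, p \oc a = 0, c \oc i = 0
      & a \oc c + i \oc p = idm B].
Proof.
move=> ca; have [D [p [h d]]] := dist_cone a.
have d1 := (dist_rot _ _ _).1 d; have d2 := (dist_rot _ _ _).1 d1.
have h0 : h = 0.
  have := dist_comp0 d2; rewrite compNm => /eqP; rewrite oppr_eq0 => /eqP ah.
  by rewrite -[h]comp1m -fmap1 -ca fmapM -compA ah compm0.
have [|j pj] := dist_lift d1 (u := idm D); first by rewrite h0 comp0m.
have pa := dist_comp0 d.
exists D, (j - a \oc (c \oc j)), p; split=> //.
- by rewrite compDr compmN compA pa comp0m subr0.
- by rewrite compDr compmN compA ca comp1m subrr.
(* The difference of the two sides is killed by [p], hence equals some [a w]; [c] kills it too, and
   [c a = 1] forces [w = 0]. *)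
have [|w aw] := dist_lift d
    (u := idm B - (a \oc c + (j - a \oc (c \oc j)) \oc p)).
  rewrite compDr compmN compDr compm1 (compA p a) pa comp0m add0r.
  by rewrite compA compDr compmN (compA p a) pa comp0m subr0 pj comp1m subrr.
suff w0 : w = 0.
  by move/eqP: aw; rewrite w0 compm0 eq_sym subr_eq0 => /eqP.
rewrite -[w]comp1m -ca -compA aw compDr compmN compDr compm1 (compA c a) ca.
rewrite comp1m (compA c) compDr compmN (compA c a) ca comp1m subrr comp0m.
by rewrite addr0 subrr.
Qed.

End Triangulated.

(** * Orthogonality and the functor H^0 of a t-structure *)

Section TStructure.
Variables (T : triangulated_cat) (t : tstructure T).
Implicit Types X Y Z W : T.

(** Testing X[n] itself removes the existential of [shifted]; [shifted_leP] and [shifted_geP]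
    compare the two forms. *)
Definition tle (n : int) X : Prop := le0 t (sh n X).
Definition tge (n : int) X : Prop := ge0 t (sh n X).

Lemma shifted_geP n X : shifted (ge0 t) n X <-> tge n X.
Proof.
split=> [[Y gY XY]|gX].
  apply: ge0_iso gY; apply: isomorphic_sym.
  apply: isomorphic_trans (isomorphic_fmap (sh n) XY) _.
  exact/isomorphic_shK/addNr.
by exists (sh n X) => //; apply/isomorphic_sym/isomorphic_shK/subrr.
Qed.

Lemma shifted_leP n X : shifted (le0 t) n X <-> tle n X.
Proof.
split=> [[Y gY XY]|gX].
  apply: le0_iso gY; apply: isomorphic_sym.
  apply: isomorphic_trans (isomorphic_fmap (sh n) XY) _.
  exact/isomorphic_shK/addNr.
by exists (sh n X) => //; apply/isomorphic_sym/isomorphic_shK/subrr.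
Qed.

Lemma tle0 X : tle 0 X <-> le0 t X.
Proof.
have e : isomorphic (sh 0 X) X by constructor; apply: shift0.
by split; apply: le0_iso => //; apply: isomorphic_sym.
Qed.

Lemma tge0 X : tge 0 X <-> ge0 t X.
Proof.
have e : isomorphic (sh 0 X) X by constructor; apply: shift0.
by split; apply: ge0_iso => //; apply: isomorphic_sym.
Qed.

Lemma tge_iso n X Y : isomorphic X Y -> tge n X -> tge n Y.
Proof. by move=> XY; apply/ge0_iso/isomorphic_fmap. Qed.

Lemma tle_sh m n X : tle n (sh m X) <-> tle (m + n) X.
Proof.
by split; apply: le0_iso; [|apply: isomorphic_sym]; apply: isomorphic_shD.
Qed.

Lemma tge_sh m n X : tge n (sh m X) <-> tge (m + n) X.
Proof.
by split; apply: ge0_iso; [|apply: isomorphic_sym]; apply: isomorphic_shD.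
Qed.

Lemma tle_mono m n X : m <= n -> tle m X -> tle n X.
Proof.
move=> mn; have -> : n = m + `|n - m|%N%:Z by lia.
elim: `|n - m|%N => [|k IH] lX; first by rewrite addr0.
by rewrite -addn1 PoszD addrA; apply/tle_sh/tle0/tle_sh/le0_sh1/IH.
Qed.

Lemma tge_mono m n X : m <= n -> tge n X -> tge m X.
Proof.
move=> mn; have {1}-> : n = m + `|n - m|%N%:Z by lia.
elim: `|n - m|%N => [|k IH] gX; first by rewrite addr0 in gX.
apply/IH; rewrite -addn1 PoszD addrA in gX.
by apply/ge1_ge0/shifted_geP/tge_sh.
Qed.

Lemma hom_tle_tge m n X Y (f : mor X Y) : m < n -> tle m X -> tge n Y -> f = 0.
Proof.
move=> mn lX gY; apply: (@sh_faithful _ m); rewrite fmap0.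
apply: (hom_le0_ge1 lX); apply/shifted_geP/tge_sh.
by apply: tge_mono gY; lia.
Qed.

(** The map from X to its truncation in A^{>=1} vanishes, so the identity lifts to a section [s] of
    [tr_in]. Both [s tr_in] and the identity lift [tr_in] along itself, hence they agree. *)
Lemma le0_orthogonal X :
  (forall W, tge 1 W -> forall f : mor X W, f = 0) -> le0 t X.
Proof.
move=> h; have d := tr_dist (trunc_of t X).
have [|s sP] := dist_lift d (u := idm X).
  by rewrite compm1; apply/h/shifted_geP/tr_geP.
apply: le0_iso (tr_leP (trunc_of t X)); constructor.
exists (tr_in (trunc_of t X)) s => //.
have [u [_ uU]] := tau_le0_ump (tr_in (trunc_of t X)) (tr_leP (trunc_of t X)).
by rewrite -(uU (idm _)) ?compm1 // -(uU (s \oc _)) // compA sP comp1m.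
Qed.

Lemma ge1_orthogonal X :
  (forall W, le0 t W -> forall f : mor W X, f = 0) -> tge 1 X.
Proof.
move=> h; have d := tr_dist (trunc_of t X).
have [|s sP] := dist_ext d (u := idm X); first by rewrite comp1m; exact: h (tr_leP _) _.
apply/shifted_geP; have [Y gY XY] := tr_geP (trunc_of t X).
exists Y => //; apply: isomorphic_trans XY; constructor.
exists (tr_pr (trunc_of t X)) s => //.
have [u [_ uU]] := tau_ge1_ump (tr_pr (trunc_of t X)) (tr_geP (trunc_of t X)).
by rewrite -(uU (idm _)) ?comp1m // -(uU (_ \oc s)) // -compA sP compm1.
Qed.

Lemma tle_orthogonal n X :
  (forall W, tge (n + 1) W -> forall f : mor X W, f = 0) -> tle n X.
Proof.
move=> h; apply: le0_orthogonal => W gW f.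
apply: (@sh_faithful _ (- n)); rewrite fmap0.
rewrite -[LHS]compm1 -(shKVK (subrr n)) compA [X in X \oc _]h ?comp0m //.
by apply/tge_sh; rewrite addrA addNr.
Qed.

Lemma tge_orthogonal n X :
  (forall W, tle (n - 1) W -> forall f : mor W X, f = 0) -> tge n X.
Proof.
move=> h; rewrite -[n](subrK 1); apply/tge_sh/ge1_orthogonal => W lW f.
apply: (@sh_faithful _ (1 - n)); rewrite fmap0.
have e' : n - 1 + (1 - n) = 0 by lia.
rewrite -[LHS]comp1m -(shKVK e') -compA [X in _ \oc X]h ?compm0 //.
by apply/tle_sh; rewrite addrC e'; apply/tle0.
Qed.

(** Maps into and out of H^0(X) are controlled through the span X <- tau_{<=0} X -> H^0(X) with legs
    [coh0_in] and [coh0_pr]. *)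
Definition coh0_in X : mor (tau_le0 t X) X := tr_in (trunc_of t X).

Definition coh0_pr X : mor (tau_le0 t X) (coh0 t X) :=
  fmap (sh 1) (tr_pr (trunc_of t (sh (-1) (tau_le0 t X)))) \oc
  shKV (addNr 1) (tau_le0 t X).

Lemma coh0_inP W X (f : mor W X) : le0 t W -> exists u, coh0_in X \oc u = f.
Proof. by move=> lW; have [u []] := tau_le0_ump f lW; exists u. Qed.

Lemma coh0_in_mono W X (u v : mor W (tau_le0 t X)) :
  le0 t W -> coh0_in X \oc u = coh0_in X \oc v -> u = v.
Proof.
move=> lW uv; have [w [_ wU]] := tau_le0_ump (coh0_in X \oc v) lW.
by rewrite -(wU u) // -(wU v).
Qed.

Lemma shifted_sh_opp n X : ge0 t X -> shifted (ge0 t) n (sh (- n) X).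
Proof. by move=> gX; exists X => //; apply: isomorphic_refl. Qed.

Lemma coh0_prP X W (f : mor (tau_le0 t X) W) :
  ge0 t W -> exists u, u \oc coh0_pr X = f.
Proof.
move=> gW; have [u [uP _]] := tau_ge1_ump (fmap (sh (-1)) f) (shifted_sh_opp 1 gW).
exists (shK (addNr 1) W \oc fmap (sh 1) u).
rewrite /coh0_pr compA -(compA (shK _ _)) -fmapM uP shK_nat -compA shKK.
by rewrite compm1.
Qed.

(** [tau_ge1_ump] concerns targets in A^{>=1}, so [u] and [v] are first desuspended to maps [u'] and
    [v'] with target W[-1]. *)
Lemma coh0_pr_epi X W (u v : mor (coh0 t X) W) :
  ge0 t W -> u \oc coh0_pr X = v \oc coh0_pr X -> u = v.
Proof.
move=> gW uv.
set s := shKV (addNr 1) W; set p := tr_pr (trunc_of t (sh (-1) (tau_le0 t X))).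
have [u' u'P] := sh_full (subrr 1) (s \oc u).
have [v' v'P] := sh_full (subrr 1) (s \oc v).
have su : shK (addNr 1) W \oc (s \oc u) = u by rewrite compA shKK comp1m.
have sv : shK (addNr 1) W \oc (s \oc v) = v by rewrite compA shKK comp1m.
suff uv' : u' = v' by rewrite -su -sv -u'P -v'P uv'.
have uvp : u \oc fmap (sh 1) p = v \oc fmap (sh 1) p.
  rewrite -[fmap _ p]compm1 -(shKVK (addNr 1)) (compA _ (shKV _ _)).
  by rewrite (compA u) (compA v) uv.
have [w [_ wU]] := tau_ge1_ump (v' \oc p) (shifted_sh_opp 1 gW).
rewrite -(wU v') // -(wU u') //; apply: (@sh_faithful _ 1).
by rewrite !fmapM u'P v'P -(compA s u) -(compA s v) uvp.
Qed.

Lemma coh0_mapP X Y (f : mor X Y) : exists u,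
  coh0_in Y \oc u = f \oc coh0_in X /\
  coh0_map t f \oc coh0_pr X = coh0_pr Y \oc u.
Proof.
exists (tau_le0_map t f); split; first exact: tau_le0_mapP.
rewrite /coh0_pr -compA shKV_nat (compA (fmap (sh 1) _) (fmap _ _)) -fmapM.
by rewrite tau_ge1_mapP fmapM -compA.
Qed.

Lemma coh0_ge0 X : ge0 t (coh0 t X).
Proof. exact/(shifted_geP 1)/tr_geP. Qed.

(** Compatibility with the span determines H^0(f), so functoriality of H^0 reduces to composing and
    adding maps of truncations. *)
Lemma coh0_map_unique X Y (f : mor X Y) g u :
  coh0_in Y \oc u = f \oc coh0_in X -> g \oc coh0_pr X = coh0_pr Y \oc u ->
  g = coh0_map t f.
Proof.
move=> uP gP; apply: coh0_pr_epi; first exact: coh0_ge0.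
have [v [vP ->]] := coh0_mapP f; rewrite gP; congr (_ \oc _).
by apply: coh0_in_mono; [apply: tr_leP|rewrite uP].
Qed.

Definition coh0_functor : add_functor T T.
Proof.
exists (coh0 t) (coh0_map t).
- move=> X; symmetry; apply: (@coh0_map_unique _ _ _ _ (idm _)).
  + by rewrite comp1m compm1.
  + by rewrite comp1m compm1.
- move=> X Y Z g f.
  have [u [uf pu]] := coh0_mapP f; have [v [vg pv]] := coh0_mapP g.
  symmetry; apply: (@coh0_map_unique _ _ _ _ (v \oc u)).
  + by rewrite compA vg -compA uf compA.
  + by rewrite -compA pu compA pv compA.
- move=> X Y f g.
  have [u [uf pu]] := coh0_mapP f; have [v [vg pv]] := coh0_mapP g.
  symmetry; apply: (@coh0_map_unique _ _ _ _ (u + v)).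
  + by rewrite compDr compDl uf vg.
  + by rewrite compDr compDl pu pv.
Defined.

Lemma coh0_map1 X : coh0_map t (idm X) = idm _.
Proof. exact: fmap1 coh0_functor X. Qed.

Lemma coh0_mapM X Y Z (g : mor Y Z) (f : mor X Y) :
  coh0_map t (g \oc f) = coh0_map t g \oc coh0_map t f.
Proof. exact: fmapM coh0_functor _ _ _ g f. Qed.

Lemma coh0_le0 X : le0 t (coh0 t X).
Proof.
apply: le0_orthogonal => W gW f; apply: coh0_pr_epi.
  by apply/tge0; apply: tge_mono gW.
rewrite comp0m; apply: (@hom_tle_tge 0 1) => //.
by apply/tle0; apply: tr_leP.
Qed.

Lemma coh0_pr0 X : coh0_pr X = 0 -> idm (coh0 t X) = 0.
Proof.
by move=> p0; apply: coh0_pr_epi; [apply: coh0_ge0|rewrite p0 !compm0].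
Qed.

Lemma coh0_tle X : tle (-1) X -> idm (coh0 t X) = 0.
Proof.
move=> lX; apply: coh0_pr0.
have l0X : le0 t X by apply/tle0; apply: tle_mono lX.
have [s sP] := coh0_inP (idm X) l0X.
(* [coh0_in] is thus invertible, and [coh0_pr] factors through X in A^{<=-1}, which has no nonzero
   map to A^{>=0}. *)
have Ks : s \oc coh0_in X = idm _.
  by apply: coh0_in_mono; [apply: tr_leP|rewrite compA sP comp1m compm1].
rewrite -[LHS]compm1 -Ks compA [X in X \oc _](@hom_tle_tge (-1) 0) ?comp0m //.
exact/tge0/coh0_ge0.
Qed.

Lemma coh0_tge X : tge 1 X -> idm (coh0 t X) = 0.
Proof.
move=> gX; apply: coh0_pr0.
rewrite -[LHS]compm1 (@coh0_in_mono _ _ (idm _) 0) ?compm0 //; first exact: tr_leP.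
rewrite compm1; apply: (@hom_tle_tge 0 1) => //.
by apply/tle0; apply: tr_leP.
Qed.

(** As X lies in A^{>=0}, [coh0_in] itself factors through [coh0_pr]; the factor is the bottom
    truncation H^0(X) -> X. *)
Lemma coh0_incl_ex X : ge0 t X -> exists a : mor (coh0 t X) X,
  a \oc coh0_pr X = coh0_in X /\
  (forall W (f : mor W X), le0 t W -> exists g, f = a \oc g).
Proof.
move=> gX; have [a aP] := coh0_prP (coh0_in X) gX; exists a; split=> // W f lW.
have [u <-] := coh0_inP f lW.
by exists (coh0_pr X \oc u); rewrite compA aP.
Qed.

Lemma coh0_proj_ex Y : le0 t Y -> exists b : mor Y (coh0 t Y),
  [/\ b \oc coh0_in Y = coh0_pr Y,
      forall W (f : mor Y W), ge0 t W -> exists g, f = g \oc b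
    & forall W (g h : mor (coh0 t Y) W), ge0 t W -> g \oc b = h \oc b -> g = h].
Proof.
move=> lY; have [s sP] := coh0_inP (idm Y) lY.
have Ks : s \oc coh0_in Y = idm _.
  by apply: coh0_in_mono; [apply: tr_leP|rewrite compA sP comp1m compm1].
exists (coh0_pr Y \oc s); split.
- by rewrite -compA Ks compm1.
- move=> W f gW; have [g gP] := coh0_prP (f \oc coh0_in Y) gW.
  by exists g; rewrite compA gP -compA sP compm1.
- move=> W g h gW gh; apply: (coh0_pr_epi gW).
  by rewrite -[coh0_pr Y]compm1 -Ks (compA (coh0_pr Y)) !(compA _ _ (coh0_in Y)) gh.
Qed.

(** This turns invertibility of H^0(f) into splittings: [a] then acquires a retraction and [b] a
    section. *)
Lemma coh0_map_factor X Y (f : mor X Y) (a : mor (coh0 t X) X)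
    (b : mor Y (coh0 t Y)) :
  a \oc coh0_pr X = coh0_in X -> b \oc coh0_in Y = coh0_pr Y ->
  b \oc f \oc a = coh0_map t f.
Proof.
move=> aP bP; have [u [uP _]] := coh0_mapP f.
apply: (@coh0_map_unique _ _ _ _ u) => //.
by rewrite -(compA _ a) aP -(compA b) -uP compA bP.
Qed.

End TStructure.

(** * Equivalences are fully faithful *)

Section Equivalence.
Variables (C D : preadditive_cat) (F : add_functor C D).
Hypothesis eqF : is_equivalence F.

Lemma equivalence_faithful X Y (f g : mor X Y) : fmap F f = fmap F g -> f = g.
Proof.
have [G [eta [eps [etaP _]]]] := eqF => fg.
by rewrite -[f]comp1m -[g]comp1m -!(ifwdK (eta Y)) -!compA !etaP fg.
Qed.

Lemma equivalence_full X Y (c : mor (F X) (F Y)) : exists f, fmap F f = c.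
Proof.
have [G [eta [eps [etaP epsP]]]] := eqF.
exists (iinv (eta Y) \oc fmap G c \oc eta X).
set f := _ \oc _ \oc _.
have Gf : fmap G (fmap F f) = fmap G c.
  rewrite -[LHS]compm1 -(iinvK (eta X)) compA -etaP /f.
  by rewrite !compA iinvK comp1m -compA iinvK compm1.
rewrite -[LHS]compm1 -[RHS]compm1 -(iinvK (eps (F X))) !compA.
by rewrite -!epsP Gf.
Qed.

End Equivalence.

(** * Iterated twists and the splitting of truncations *)

Section Twist.
Variables (T : triangulated_cat) (t : tstructure T).
Variables (F : auto_equivalence T) (hF : t_exact t F).
Implicit Types X Y Z W : T.

Lemma tle_auto n X : tle t n X -> tle t n (F X).
Proof.
by move=> lX; apply: le0_iso (hF.1 _ lX); constructor; apply: aeshift.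
Qed.

Lemma tge_auto n X : tge t n X -> tge t n (F X).
Proof.
by move=> gX; apply: ge0_iso (hF.2 _ gX); constructor; apply: aeshift.
Qed.

(** A quasi-inverse [G] also preserves A^{>=0}, by orthogonality: [F] is faithful and sends a map
    from A^{<=-1} to [G W] to a map from A^{<=-1} to an object isomorphic to W, hence to zero. *)
Lemma ge0_auto_ess_surj W : ge0 t W ->
  exists2 W0, ge0 t W0 & isomorphic W (F W0).
Proof.
move=> gW; have [G [eta [eps _]]] := ae_equiv F.
have WG : isomorphic W (F (G W)) by apply: isomorphic_sym; constructor; apply: eps.
exists (G W) => //; apply/tge0/tge_orthogonal => X lX f.
apply: (equivalence_faithful (ae_equiv F)); rewrite fmap0.
apply: (@hom_tle_tge _ t (0 - 1) 0) => //; first exact: tle_auto.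
by apply: tge_iso WG _; apply/tge0.
Qed.

Definition twist_functor (n : nat) : add_functor T T.
Proof.
exists (@twist T F n) (@twist_map T F n).
- by elim: n => [|n IH] X //=; rewrite fmap1 IH.
- by elim: n => [|n IH] X Y Z g f //=; rewrite fmapM IH.
- by elim: n => [|n IH] X Y f g //=; rewrite fmapD IH.
Defined.

Lemma twist_mapM n X Y Z (g : mor Y Z) (f : mor X Y) :
  twist_map F n (g \oc f) = twist_map F n g \oc twist_map F n f.
Proof. exact: fmapM (twist_functor n) _ _ _ g f. Qed.

Lemma twist_map1 n X : twist_map F n (idm X) = idm _.
Proof. exact: fmap1 (twist_functor n) X. Qed.

Lemma twist_full n X Y (c : mor (twist F n X) (twist F n Y)) :
  exists f, twist_map F n f = c.
Proof.
elim: n X Y c => [|n IH] X Y c /=; first by exists c.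
have [g <-] := IH _ _ c; have [f <-] := equivalence_full (ae_equiv F) g.
by exists f.
Qed.

Lemma twist_faithful n X Y (f g : mor X Y) :
  twist_map F n f = twist_map F n g -> f = g.
Proof.
elim: n X Y f g => [|n IH] X Y f g //= /IH.
exact: equivalence_faithful (ae_equiv F) _ _ _ _.
Qed.

Lemma tle_twist n m X : tle t m X -> tle t m (twist F n X).
Proof. by elim: n X => [|n IH] X //= lX; apply/IH/tle_auto. Qed.

Lemma tge_twist n m X : tge t m X -> tge t m (twist F n X).
Proof. by elim: n X => [|n IH] X //= lX; apply/IH/tge_auto. Qed.

Lemma ge0_twist_ess_surj n W : ge0 t W ->
  exists2 W0, ge0 t W0 & isomorphic W (twist F n W0).
Proof.
elim: n W => [|n IH] W gW; first by exists W => //; apply: isomorphic_refl.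
have [W1 gW1 WW1] := IH _ gW; have [W0 gW0 W10] := ge0_auto_ess_surj gW1.
exists W0 => //; apply: isomorphic_trans WW1 _.
exact: isomorphic_fmap (twist_functor n) _ _ W10.
Qed.

(* A section [u] of the top truncation of Y(n) descends to Y because Y(n) and
   Y have the same maps, up to twist, to objects of A^{>=0}. *)
Lemma coh0_proj_split n Y (b : mor Y (coh0 t Y))
    (b' : mor (twist F n Y) (coh0 t (twist F n Y))) u :
  (forall W (f : mor Y W), ge0 t W -> exists g, f = g \oc b) ->
  (forall W (g h : mor (coh0 t Y) W), ge0 t W -> g \oc b = h \oc b -> g = h) ->
  (forall W (f : mor (twist F n Y) W), ge0 t W -> exists g, f = g \oc b') ->
  b' \oc u = idm _ -> exists a, b \oc a = idm (coh0 t Y).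
Proof.
move=> bE bU b'E b'u.
have [W0 gW0 [om]] := ge0_twist_ess_surj n (coh0_ge0 t (twist F n Y)).
have [b0 b0P] := twist_full (om \oc b').
have [g b0E] := bE _ b0 gW0.
have tH : ge0 t (twist F n (coh0 t Y)).
  by apply/tge0/tge_twist/tge0/coh0_ge0.
have [w wP] := b'E _ (twist_map F n b) tH.
(* The twist of [h] is the round trip H^0(Y)(n) -> H^0(Y(n)) -> H^0(Y)(n) given by the two universal
   properties; it fixes b(n), so [h] is the identity. *)
have [h hP] := twist_full (w \oc iinv om \oc twist_map F n g).
have h1 : h = idm _.
  apply: bU; first exact: coh0_ge0.
  rewrite comp1m; apply: (@twist_faithful n).
  rewrite twist_mapM hP -!compA.
  rewrite -twist_mapM -b0E b0P.
  by rewrite (compA (iinv om)) ifwdK comp1m -wP.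
have [a aP] := twist_full (u \oc iinv om \oc twist_map F n g).
exists a; apply: (@twist_faithful n).
rewrite twist_mapM aP wP !compA -(compA w b') b'u compm1.
by rewrite -hP h1 twist_map1.
Qed.

(** Let [th] be the inverse of [b' f a = H^0(f)]. Then [th b' f] is a retraction of [a], while
    [f a th] is a section of [b'], which descends to a section of [b]. *)
Lemma coh0_split n X Y (f : mor X (twist F n Y)) :
  ge0 t X -> le0 t Y -> is_iso (coh0_map t f) ->
  (exists (a : mor (coh0 t X) X) (c : mor X (coh0 t X)), c \oc a = idm _ /\
     forall W (g : mor W X), le0 t W -> exists h, g = a \oc h) /\
  (exists (a : mor (coh0 t Y) Y) (c : mor Y (coh0 t Y)), c \oc a = idm _ /\
     forall W (g : mor Y W), ge0 t W -> exists h, g = h \oc c).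
Proof.
move=> gX lY [th [thf fth]].
have ltY : le0 t (twist F n Y) by apply/tle0/tle_twist/tle0.
have [a [aP aU]] := coh0_incl_ex gX.
have [b [bP bE bU]] := coh0_proj_ex lY.
have [b' [b'P b'E b'U]] := coh0_proj_ex ltY.
have fE := coh0_map_factor f aP b'P.
split.
  by exists a, (th \oc b' \oc f); split=> //; rewrite -!compA (compA b') fE.
have [|s sP] := @coh0_proj_split n Y b b' (f \oc a \oc th) bE bU b'E.
  by rewrite !compA fE.
by exists s, b; split.
Qed.

End Twist.

(** Carries a splitting found on B[-k] back to B. The isomorphism [e] lets H^{-k}(A) stand in for
    H^{-k}(B), so that all summands are expressed by A. *)
Lemma shift_split (T : triangulated_cat) k (B H H' : T) (e : iso H' H)
    (a : mor H (sh (- k) B)) (c : mor (sh (- k) B) H) : c \oc a = idm H ->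
  exists (a' : mor (sh k H') B) (c' : mor B (sh k H')),
  [/\ c' \oc a' = idm _,
      forall W (g : mor W B), (exists h, fmap (sh (- k)) g = a \oc h) ->
        exists h, g = a' \oc h
    & forall W (g : mor B W), (exists h, fmap (sh (- k)) g = h \oc c) ->
        exists h, g = h \oc c'].
Proof.
move=> ca; pose kk := addNr k.
exists (shK kk B \oc fmap (sh k) (a \oc e)).
exists (fmap (sh k) (iinv e \oc c) \oc shKV kk B); split.
- rewrite -compA (compA (shKV _ _)) shKVK comp1m -fmapM -compA (compA c) ca.
  by rewrite comp1m ifwdK fmap1.
- move=> W g [h gh]; exists (fmap (sh k) (iinv e \oc h) \oc shKV kk W).
  rewrite -compA (compA (fmap _ _)) -fmapM -(compA a) (compA (ifwd e)) iinvK comp1m.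
  by rewrite -gh -shKV_nat compA shKK comp1m.
- move=> W g [h gh]; exists (shK kk W \oc fmap (sh k) (h \oc e)).
  rewrite -compA (compA (fmap _ _)) -fmapM -(compA h) (compA (ifwd e)) iinvK comp1m.
  by rewrite -gh compA shK_nat -compA shKK compm1.
Qed.

Lemma is_iso_comp (C : preadditive_cat) (X Y Z : C) (g : mor Y Z) (f : mor X Y) :
  is_iso g -> is_iso f -> is_iso (g \oc f).
Proof.
move=> [g' [g'g gg']] [f' [f'f ff']]; exists (f' \oc g'); split.
- by rewrite -compA (compA g') g'g comp1m f'f.
- by rewrite -compA (compA f) ff' comp1m gg'.
Qed.

(** * Splitting off the extreme cohomologies of a retract of A *)

Section Decomposition.
Variables (T : triangulated_cat) (t : tstructure T).
Variables (F : auto_equivalence T) (hF : t_exact t F) (A : T).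
(** [psi n] stands for [phi_iter phi n]. *)
Variable psi : forall n : nat, mor (sh (- n%:Z) A) (twist F n (sh n%:Z A)).
Hypothesis psi_iso : forall n : nat, (1 <= n)%N -> is_iso (coh0_map t (psi n)).

(** The twist sits inside H^0, as in the target H^0(A[n](n)) of H^0(phi^n). *)
Definition twisted_coh (m : nat) (j : int) : add_functor T T :=
  comp_functor (coh0_functor t) (comp_functor (twist_functor F m) (sh j)).

Definition coh_summand (k : int) : T := sh k (coh t (- k) A).

Lemma coh_summand_tle k : tle t (- k) (coh_summand k).
Proof. by apply/tle_sh; rewrite subrr; apply/tle0/coh0_le0. Qed.

Lemma coh_summand_tge k : tge t (- k) (coh_summand k).
Proof. by apply/tge_sh; rewrite subrr; apply/tge0/coh0_ge0. Qed.

Lemma coh_summand_outside n : tle t n A -> tge t (- n) A ->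
  forall k : int, n < `|k| -> idm (coh_summand k) = 0.
Proof.
move=> lA gA k nk; rewrite -fmap1 /coh [idm _](_ : _ = 0) ?fmap0 //.
have [k0|k0] := leP 0 k.
- by apply/coh0_tge/tge_sh; apply: tge_mono gA; lia.
- by apply/coh0_tle/tle_sh; apply: tle_mono lA; lia.
Qed.

Lemma twisted_coh_tle m j X : tle t (j - 1) X -> idm (twisted_coh m j X) = 0.
Proof. by move=> lX; apply: coh0_tle; apply/tle_twist/tle_sh. Qed.

Lemma twisted_coh_tge m j X : tge t (j + 1) X -> idm (twisted_coh m j X) = 0.
Proof. by move=> lX; apply: coh0_tge; apply/tge_twist/tge_sh. Qed.

Lemma fmap_through0 (G : add_functor T T) (X Y Z : T) (f : mor Y Z) (g : mor X Y) :
  idm (G Y) = 0 -> fmap G (f \oc g) = 0.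
Proof. by move=> G0; rewrite fmapM -[fmap G g]comp1m G0 comp0m compm0. Qed.

(** Since [p i = 1], the condition on [i p] says that [i] and [p] induce inverse isomorphisms on
    cohomology; in this form it passes to complements by additivity. *)
Definition same_coh (n : nat) (B : T) (i : mor B A) (p : mor A B) : Prop :=
  p \oc i = idm B /\
  forall (m : nat) (j : int), `|j| <= n%:Z ->
    fmap (twisted_coh m j) (i \oc p) = idm _.

Lemma same_coh_fwd n B (i : mor B A) p m j : same_coh n i p -> `|j| <= n%:Z ->
  is_iso (fmap (twisted_coh m j) i).
Proof.
move=> [pi ip] jn; exists (fmap (twisted_coh m j) p).
by rewrite -!fmapM pi fmap1 ip.
Qed.

Lemma same_coh_bwd n B (i : mor B A) p m j : same_coh n i p -> `|j| <= n%:Z ->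
  is_iso (fmap (twisted_coh m j) p).
Proof.
move=> [pi ip] jn; exists (fmap (twisted_coh m j) i).
by rewrite -!fmapM pi fmap1 ip.
Qed.

Lemma same_coh_iso n B (i : mor B A) p j : same_coh n i p -> `|j| <= n%:Z ->
  isomorphic (coh t j A) (coh t j B).
Proof.
move=> [pi ip] jn; constructor.
exists (fmap (twisted_coh 0 j) p) (fmap (twisted_coh 0 j) i).
- by rewrite -fmapM ip.
- by rewrite -fmapM pi fmap1.
Qed.

Lemma split_extremes n B (i : mor B A) p :
  same_coh n.+1 i p -> tle t n.+1 B -> tge t (- n.+1%:Z) B ->
  (exists (a : mor (coh_summand n.+1) B) (c : mor B (coh_summand n.+1)),
    c \oc a = idm _ /\
    forall W (g : mor W B), tle t (- n.+1%:Z) W -> exists h, g = a \oc h) /\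
  (exists (a : mor (coh_summand (- n.+1%:Z)) B) (c : mor B (coh_summand (- n.+1%:Z))),
    c \oc a = idm _ /\
    forall W (g : mor B W), tge t n.+1 W -> exists h, g = h \oc c).
Proof.
move=> ip lB gB; set N := n.+1%:Z.
have NN : `|N| <= N by lia. have NN' : `|- N| <= N by lia.
(* The composite B[-N] -> A[-N] -> A[N](N) -> B[N](N); each factor is invertible on H^0. *)
pose f := twist_map F n.+1 (fmap (sh N) p) \oc psi n.+1 \oc fmap (sh (- N)) i.
have [|[a [c [ca aU]]] [b [d [db dU]]]] := @coh0_split T t F hF n.+1 _ _ f gB lB.
  rewrite /f !coh0_mapM.
  apply: is_iso_comp; first apply: is_iso_comp.
  - exact: (same_coh_bwd n.+1 ip NN).
  - exact: psi_iso.
  - exact: (same_coh_fwd 0 ip NN').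
split.
- have [e] := same_coh_iso ip NN'.
  have [a' [c' [ca' aU' _]]] := shift_split e ca.
  by exists a', c'; split=> // W g lW; apply/aU'/aU.
(* N is written as -(-N) so that [shift_split] applies with k = -N. *)
- have [e] := same_coh_iso ip NN; rewrite -[N in sh N B]opprK in b d db dU.
  rewrite -[N in coh t N]opprK in e.
  have [b' [d' [db' _ dU']]] := shift_split e db.
  exists b', d'; split=> // W g gW; apply/dU'/dU.
  by rewrite opprK.
Qed.

(** The two splittings are made orthogonal in turn: [C] is the complement of the first, the second
    is projected into [C], and [D] is its complement there. *)
Lemma split_off n B (i : mor B A) p :
  same_coh n.+1 i p -> tle t n.+1 B -> tge t (- n.+1%:Z) B ->
  exists (a : mor (coh_summand n.+1) B) (c : mor B (coh_summand n.+1))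
    (a' : mor (coh_summand (- n.+1%:Z)) B) (c' : mor B (coh_summand (- n.+1%:Z)))
    (D : T) (j : mor D B) (q : mor B D),
  [/\ c \oc a = idm _ /\ c' \oc a' = idm _, c \oc a' = 0 /\ c' \oc a = 0,
      [/\ c \oc j = 0, c' \oc j = 0, q \oc a = 0, q \oc a' = 0 & q \oc j = idm D],
      a \oc c + a' \oc c' + j \oc q = idm B
    & [/\ same_coh n (i \oc j) (q \oc p), tle t n D & tge t (- n%:Z) D] ].
Proof.
move=> ip lB gB.
have [[a [c [ca aU]]] [a0 [c' [ca0 cU]]]] := split_extremes ip lB gB.
(* The source lies in A^{<=-n-1} and the target in A^{>=n+1}. *)
have c'a : c' \oc a = 0.
  by apply: (hom_tle_tge _ _ (coh_summand_tle _) (coh_summand_tge _)); lia.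
have [C [j1 [q1 [qj1 qa1 cj1 e1]]]] := split_mono_complement ca.
have j1q1 : j1 \oc q1 = idm B - a \oc c by rewrite -e1 addrC addKr.
have ca2 : (c' \oc j1) \oc (q1 \oc a0) = idm _.
  rewrite -compA (compA j1) j1q1 compDl compNm comp1m compDr compmN !compA c'a.
  by rewrite !comp0m subr0.
have [D [j2 [q2 [qj2 qa2 cj2 e2]]]] := split_mono_complement ca2.
(* [a0] is replaced by its component in [C], which [c] kills and which is still a section of [c']
   because [c' a = 0]. *)
exists a, c, (j1 \oc (q1 \oc a0)), c', D, (j1 \oc j2), (q2 \oc q1).
have c'E : c' \oc j1 \oc q1 = c'.
  by rewrite -compA j1q1 compDr compmN compA c'a comp0m subr0 compm1.
have c'j : c' \oc (j1 \oc j2) = 0 by rewrite compA.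
have qa : q2 \oc q1 \oc a = 0 by rewrite -compA qa1 compm0.
have qj : q2 \oc q1 \oc (j1 \oc j2) = idm D.
  by rewrite -compA (compA q1) qj1 comp1m.
have e : a \oc c + j1 \oc (q1 \oc a0) \oc c' + j1 \oc j2 \oc (q2 \oc q1) = idm B.
  rewrite -[in c'](c'E) -e1 -addrA; congr (_ + _).
  rewrite -[in RHS](compm1 j1) -e2 compDr compDl.
  by rewrite -!compA.
split=> //.
- by split=> //; rewrite compA.
- by rewrite compA cj1 comp0m.
- split=> //; first by rewrite compA cj1 comp0m.
  by rewrite -compA (compA q1) qj1 comp1m.
split; first split.
- by rewrite -compA (compA p) ip.1 comp1m.
(* Expanding the identity of B in [i p] by [e], the terms through the two summands vanish on H^k for
   |k| <= n, as these summands sit in degrees -n-1 and n+1. *)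
- move=> m k kn; rewrite -(ip.2 m k); last by lia.
  rewrite -[in RHS](comp1m p) -e !compDl !compDr !fmapD.
  rewrite [X in X + _ + _](_ : _ = 0); last first.
    rewrite -compA compA; apply: fmap_through0; apply: twisted_coh_tle.
    by apply: tle_mono (coh_summand_tle _); lia.
  rewrite [X in _ + X + _](_ : _ = 0); last first.
    rewrite -compA compA; apply: fmap_through0; apply: twisted_coh_tge.
    by apply: tge_mono (coh_summand_tge _); lia.
  by rewrite !add0r !compA.
(* Maps from B to A^{>=n+1} factor through [c'], which vanishes on [D]; dually below, maps from
   A^{<=-n-1} to B factor through [a], which the projection to [D] kills. *)
- apply: tle_orthogonal => W gW f.
  have [|h hE] := cU W (f \oc (q2 \oc q1)); first by apply: tge_mono gW; lia.
  by rewrite -[f]compm1 -qj compA hE -compA c'j compm0.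
- apply: tge_orthogonal => W lW f.
  have [|h hE] := aU W (j1 \oc j2 \oc f); first by apply: tle_mono lW; lia.
  by rewrite -[f]comp1m -qj -compA hE compA qa comp0m.
Qed.

(** The family [in_] is total, as [is_direct_sum] demands, but the universal property constrains it
    only for |k| <= n, which lets the induction extend it two indices at a time. *)
Lemma partial_direct_sum n B (i : mor B A) p :
  same_coh n i p -> tle t n B -> tge t (- n%:Z) B ->
  exists in_ : forall k, mor (coh_summand k) B,
    (forall Y (f : forall k, mor (coh_summand k) Y),
      exists u : mor B Y, forall k : int, `|k| <= n%:Z -> u \oc in_ k = f k) /\
    (forall Y (u v : mor B Y),
      (forall k : int, `|k| <= n%:Z -> u \oc in_ k = v \oc in_ k) -> u = v).
Proof.
elim: n B i p => [|n IH] B i p ip lB gB.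
  (* The index -0 reduces to 0 and has the shape that [shift_split] expects for k = 0. *)
  have gX : ge0 t (sh (- 0) B) by [].
  have lX : le0 t (sh (- 0) B) by [].
  (* For n = 0 the object lies in the heart, and the identity replaces the map induced by [psi]. *)
  have [|[a [c [ca aU]]] _] := @coh0_split T t F hF 0 _ _ (idm _) gX lX.
    by exists (idm _); rewrite coh0_map1 comp1m.
  have [e] := @same_coh_iso 0 _ _ _ (- 0) ip isT.
  have [a' [c' [ca' aU' _]]] := shift_split e ca.
  have [|h aE] := aU' B (idm B) _; first exact: aU.
  pose in_ := dfwith (fun k => 0 : mor (coh_summand k) B) (i := 0) a'.
  have in0 : in_ 0 = a' by rewrite /in_ dfwith_in.
  (* The identity of B factors as [a' h], and [c' a' = 1] gives [h = c']. *)
  have ac : a' \oc c' = idm B.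
    by rewrite aE -[in RHS](comp1m h) -ca' -(compA c') -aE compm1.
  exists in_; split=> [Y f|Y u v uv].
    exists (f 0 \oc c') => k; rewrite normr_le0 => /eqP ->.
    by rewrite in0 -compA ca' compm1.
  by rewrite -[u]compm1 -[v]compm1 -ac !compA -in0 uv.
have [a [c [a' [c' [D [j [q [[ca ca'] [ca0 ca0'] [cj c'j qa qa' qj] e [ip' lD gD]]]]]]]]] :=
  split_off ip lB gB.
have [inD [exD unD]] := IH _ _ _ ip' lD gD.
pose M k := mor (coh_summand k) B : Type.
(* The family of [D] pushed to B, overridden at the two new indices n+1 and -n-1. *)
pose in_ : forall k, M k :=
  dfwith (dfwith (fun k => j \oc inD k : M k) (a : M n.+1%:Z)) (a' : M (- n.+1%:Z)).
have inN : in_ n.+1%:Z = a by rewrite /in_ dfwith_out ?dfwith_in //; lia.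
have inN' : in_ (- n.+1%:Z) = a' by rewrite /in_ dfwith_in.
have in_in k : `|k| <= n%:Z -> in_ k = j \oc inD k.
  by move=> kn; rewrite /in_ !dfwith_out //; lia.
exists in_; split=> [Y f|Y u v uv].
  have [u uP] := exD Y f.
  exists (u \oc q + f n.+1%:Z \oc c + f (- n.+1%:Z) \oc c') => k kn.
  have [k_n|] := boolP (`|k| <= n%:Z).
    rewrite in_in // !compDl -!compA (compA q) qj comp1m uP //.
    by rewrite (compA c) cj (compA c') c'j !comp0m !compm0 !addr0.
  move=> kn'; have [->|->] : k = n.+1%:Z \/ k = - n.+1%:Z by lia.
  - by rewrite inN !compDl -!compA qa ca ca0' !compm0 compm1 add0r addr0.
  - by rewrite inN' !compDl -!compA qa' ca0 ca' !compm0 compm1 !add0r.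
rewrite -[u]compm1 -[v]compm1 -e !compDr; congr (_ + _ + _); rewrite !compA.
- by rewrite -inN uv //; lia.
- by rewrite -inN' uv //; lia.
- congr (_ \oc _); apply: unD => k kn; rewrite -!compA -in_in //; apply: uv; lia.
Qed.

End Decomposition.

(** * The full direct sum, with A itself as the sum *)

Theorem theorem1 (T : triangulated_cat) (t : tstructure T) (ht : tbounded t)
    (F : auto_equivalence T) (hF : t_exact t F)
    (A : T) (phi : mor (sh (-1) A) (F (sh 1 A)))
    (hphi : forall n : nat, (1 <= n)%N -> is_iso (coh0_map t (phi_iter phi n))) :
  exists (S : T) (in_ : forall k : int, mor (sh k (coh t (- k) A)) S),
    is_direct_sum in_ /\ isomorphic A S.
Proof.
have [a [b [ab /shifted_geP gA /shifted_leP lA]]] := ht A.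
(* A symmetric bound: -n <= a and b <= n. *)
pose n := (`|a| + `|b|)%N.
have {}gA : tge t (- n%:Z) A by apply: tge_mono gA; lia.
have {}lA : tle t n A by apply: tle_mono lA; lia.
have idP : same_coh t F n (idm A) (idm A).
  by split=> [|m j _]; rewrite comp1m ?fmap1.
have [in_ [exA unA]] := partial_direct_sum hF hphi idP lA gA.
exists A, in_; split; last exact: isomorphic_refl.
move=> Y f; have [u uP] := exA Y f.
exists u; split=> [k|v vP]; last by apply: unA => k kn; rewrite uP // vP.
have [kn|kn] := leP `|k| n%:Z; first exact: uP.
(* Beyond the bound the summand is zero, so both sides of the required equation vanish. *)
have E0 := coh_summand_outside lA gA kn.
by rewrite -[LHS]compm1 -[RHS]compm1 E0 !compm0.
Qed.
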